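(* Let $\mathbb{F}$ be a field. There is a polynomial $p$ such that for all $n,s\in\mathbb{N}$: if there is a noncommutative arithmetic circuit over $\mathbb{F}$ of size $s$ computing $\mathrm{Cdet}_{2n}(X)$, where $X=\{x_{ij}:1\le i,j\le 2n\}$, then there is a noncommutative arithmetic circuit over $\mathbb{F}$ of size at most $p(s,n)$ computing $\mathrm{Cperm}_n(Y)$, where $Y=\{y_{ij}:1\le i,j\le n\}$.
   Context: All variables are noncommuting. The Cayley determinant and permanent are $\mathrm{Cdet}_n(X)=\sum_{\sigma\in S_n}\mathrm{sgn}(\sigma)\,x_{1,\sigma(1)}x_{2,\sigma(2)}\cdots x_{n,\sigma(n)}$ and $\mathrm{Cperm}_n(X)=\sum_{\sigma\in S_n}x_{1,\sigma(1)}x_{2,\sigma(2)}\cdots x_{n,\sigma(n)}$ (products in the written order). A noncommutative arithmetic circuit over $\mathbb{F}$ is a directed acyclic graph whose leaves are labelled by variables or elements of $\mathbb{F}$ and whose internal nodes are addition or multiplication gates of fan-in two, each multiplication gate having a designated left and right child; gates compute polynomials in the free noncommutative polynomial ring in the natural way (products taken left times right), and the circuit computes the polynomial at a designated output gate. Size is the number of nodes. *)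

(* Defs.v *)
From HB Require Import structures.
From mathcomp Require Import all_boot all_order all_fingroup all_algebra.
From mathcomp.multinomials Require Import monalg.

Set Implicit Arguments.
Unset Strict Implicit.
Unset Printing Implicit Defensive.

Import GRing.Theory.
Local Open Scope ring_scope.

(* F<I>: noncommutative monomials are words over I, multiplied by
   concatenation. *)
Notation ncpoly F I := {malg F[{fmonom I}]}.

Section NonCommutativePolynomials.
Variables (F : fieldType) (I : choiceType).

Definition ncvar (i : I) : ncpoly F I := << fmu i >>.
Definition ncconst (c : F) : ncpoly F I := c%:MP.

End NonCommutativePolynomials.

Section Cayley.
Variables (R : nzRingType) (n : nat).
Implicit Type A : 'M[R]_n.

(* The bigop over 'I_n multiplies the factors in increasing row order, which
   matters because R is not assumed commutative. *)
Definition Cdet A : R := \sum_(s : 'S_n) (-1) ^+ s * \prod_(i < n) A i (s i).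
Definition Cperm A : R := \sum_(s : 'S_n) \prod_(i < n) A i (s i).

End Cayley.

Definition varmx (F : fieldType) (n : nat) :
    'M[ncpoly F ('I_n * 'I_n)%type]_n :=
  \matrix_(i, j) ncvar F (i, j).

Section Circuits.
Variables (F : fieldType) (I : choiceType).

(* A gate carries its children, the left one first; they may coincide. *)
Variant gate (V : Type) : Type :=
| GVar of I
| GConst of F
| GAdd of V & V
| GMul of V & V.

Definition children (V : Type) (g : gate V) : seq V :=
  match g with
  | GVar _ | GConst _ => [::]
  | GAdd u v | GMul u v => [:: u; v]
  end.

Record circuit : Type := Circuit {
  node : finType;
  label : node -> gate node;
  output : node;
  child : rel node := [rel u v | v \in children (label u)];
  circuit_acyclic : forall u v : node, child u v -> ~~ connect child v u
}.

Definition circuit_size (C : circuit) : nat := #|node C|.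

Definition gate_value (V : Type) (val : V -> ncpoly F I) (g : gate V) :
    ncpoly F I :=
  match g with
  | GVar i => ncvar F i
  | GConst c => ncconst I c
  | GAdd u v => val u + val v
  | GMul u v => val u * val v
  end.

Definition valuation (C : circuit) (val : node C -> ncpoly F I) : Prop :=
  forall u : node C, val u = gate_value val (label u).

(* By acyclicity the valuation exists and is unique, see [valuation_exists] and
   [valuation_unique]. *)
Definition computes (C : circuit) (f : ncpoly F I) : Prop :=
  exists2 val : node C -> ncpoly F I, valuation val & val (output C) = f.

Lemma child_card (C : circuit) (u v : node C) :
  child u v -> (#|connect (@child C) v| < #|connect (@child C) u|)%N.
Proof.
move=> uv; apply/proper_card/properP; split.
  by apply/subsetP=> w; apply: connect_trans; apply: connect1.
by exists u; [exact: connect0 | exact: circuit_acyclic].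
Qed.

Lemma child_ind (C : circuit) (P : node C -> Prop) :
  (forall u, (forall v, child u v -> P v) -> P u) -> forall u, P u.
Proof.
move=> IH u; have [m] := ubnP #|connect (@child C) u|.
elim: m u => // m IHm u le_u; apply: IH => v uv.
by apply: IHm; apply: leq_trans (child_card uv) _.
Qed.

Lemma eq_gate_value (V : eqType) (val1 val2 : V -> ncpoly F I) (g : gate V) :
  {in children g, val1 =1 val2} -> gate_value val1 g = gate_value val2 g.
Proof. by case: g => //= u v eq12; rewrite !eq12 ?inE ?eqxx ?orbT. Qed.

Lemma valuation_unique (C : circuit) (val1 val2 : node C -> ncpoly F I) :
  valuation val1 -> valuation val2 -> val1 =1 val2.
Proof.
move=> H1 H2; apply: child_ind => u IH.
by rewrite H1 H2; apply: eq_gate_value => v; apply: IH.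
Qed.

Lemma valuation_exists (C : circuit) :
  exists val : node C -> ncpoly F I, valuation val.
Proof.
pose step (val : node C -> ncpoly F I) u := gate_value val (label u).
pose it m := iter m step (fun=> 0).
have stable u m : (#|connect (@child C) u| <= m)%N -> it m u = it m.+1 u.
  elim/child_ind: u m => u IH [|m] le_m.
    by move: le_m; rewrite leqNgt (cardD1 u) inE connect0.
  apply: eq_gate_value => v uv; apply: IH => //.
  exact: leq_trans (child_card uv) le_m.
by exists (it #|node C|) => u; rewrite stable // max_card.
Qed.

End Circuits.

(* Main.v *)
(* Substitute (n+1) x (n+1) matrices for the variables of Cdet_2n, numbering
   rows and columns from 0: x_(2i,2j) becomes y_ij E_(0,j+1), x_(2i+1,2j+1)
   becomes E_(j+1,0), and every other variable becomes 0. A monomial survives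
   at entry (0,0) only if rows 2i and 2i+1 are sent to columns 2j and 2j+1 for a
   common j, that is, if its permutation doubles some t in S_n. It then yields
   the monomial of t in Cperm_n, with sign +1 because the doubled permutation
   is the product of two conjugate permutations. Computing every gate of the
   circuit entrywise costs a factor polynomial in n. *)
Require Import Defs.
From HB Require Import structures.
From mathcomp Require Import all_boot all_order all_fingroup all_algebra.
From mathcomp.multinomials Require Import monalg.

Set Implicit Arguments.
Unset Strict Implicit.
Unset Printing Implicit Defensive.

Import GRing.Theory.
Local Open Scope ring_scope.

(** * Substitution of matrices for noncommuting variables *)

Section Substitution.
Variables (F : fieldType) (I J : choiceType) (m : nat).
Variable h : I -> 'M[ncpoly F J]_m.+1.

Definition scalar_const : F -> 'M[ncpoly F J]_m.+1 :=
  @scalar_mx (ncpoly F J) m.+1 \o ncconst J.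

Lemma scalar_const_additive : zmod_morphism scalar_const.
Proof. by move=> c d; rewrite /scalar_const /ncconst /= !raddfB. Qed.

Lemma scalar_const_multiplicative : monoid_morphism scalar_const.
Proof.
split; first by rewrite /scalar_const /ncconst /= rmorph1.
by move=> c d; rewrite /scalar_const /ncconst /= rmorphM /= scalar_mxM.
Qed.

HB.instance Definition _ :=
  GRing.isZmodMorphism.Build _ _ scalar_const scalar_const_additive.
HB.instance Definition _ :=
  GRing.isMonoidMorphism.Build _ _ scalar_const scalar_const_multiplicative.

Definition word_subst (w : {fmonom I}) : 'M[ncpoly F J]_m.+1 :=
  \prod_(i <- w) h i.

Lemma word_subst_mmorphism : mmorphism word_subst.
Proof.
split; last by rewrite /word_subst fm1 big_nil.
by move=> v w; rewrite /word_subst fmM big_cat.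
Qed.

HB.instance Definition _ :=
  isMultiplicative.Build _ _ word_subst word_subst_mmorphism.

Definition mx_subst : ncpoly F I -> 'M[ncpoly F J]_m.+1 :=
  mmap scalar_const word_subst.

Lemma ncconst_comm (c : F) (f : ncpoly F J) : GRing.comm (ncconst J c) f.
Proof.
rewrite /GRing.comm !malgM_def fgmulUg fgmulgU.
by apply: eq_bigr => w _; rewrite mulrC mul1m mulm1.
Qed.

(** Scalar matrices over a noncommutative ring need not be central; these are, since their diagonal
    entry is a constant of [F]. This centrality is what makes [mx_subst] multiplicative. *)
Lemma scalar_const_comm (c : F) (B : 'M[ncpoly F J]_m.+1) :
  GRing.comm (scalar_const c) B.
Proof.
apply/matrixP => i j; rewrite /scalar_const /= -[_ * B]/(_ *m B).
rewrite mul_scalar_mx !mxE (bigD1 j) //=.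
rewrite !mxE eqxx mulr1n big1 ?addr0; first exact: ncconst_comm.
by move=> k /negPf kj; rewrite mxE kj mulr0n mulr0.
Qed.

Lemma mx_subst_multiplicative : monoid_morphism mx_subst.
Proof.
suff [mulM one1] : multiplicative mx_subst by split.
by apply: commr_mmap_is_multiplicative => f v w; apply: scalar_const_comm.
Qed.

HB.instance Definition _ := GRing.Additive.on mx_subst.
HB.instance Definition _ :=
  GRing.isMonoidMorphism.Build _ _ mx_subst mx_subst_multiplicative.

Lemma mx_substC (c : F) : mx_subst (ncconst I c) = (ncconst J c)%:M.
Proof. exact: mmapC. Qed.

Lemma mx_substU (i : I) : mx_subst (ncvar F i) = h i.
Proof.
by rewrite /mx_subst /ncvar mmapU /= rmorph1 mul1r /word_subst fmU big_seq1.
Qed.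

End Substitution.

(** * Index pairs and doubled permutations *)

Section HalfIndices.
Variable n : nat.

Fact ord_half_proof (r : 'I_(2 * n)) : (r./2 < n)%N.
Proof. by rewrite ltn_half_double -mul2n. Qed.

Definition ord_half (r : 'I_(2 * n)) : 'I_n := Ordinal (ord_half_proof r).

Fact ord_double_proof (b : bool) (i : 'I_n) : (b + i.*2 < 2 * n)%N.
Proof.
by rewrite mul2n; case: b; rewrite ?ltn_Sdouble ?ltn_double.
Qed.

Definition ord_double (b : bool) (i : 'I_n) : 'I_(2 * n) :=
  Ordinal (ord_double_proof b i).

Lemma odd_ord_double b i : odd (ord_double b i) = b.
Proof. by rewrite /= oddD odd_double addbF oddb. Qed.

Lemma ord_doubleK b : cancel (ord_double b) ord_half.
Proof. by move=> i; apply: val_inj; rewrite /= half_bit_double. Qed.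

Lemma ord_halfK (r : 'I_(2 * n)) : ord_double (odd r) (ord_half r) = r.
Proof. by apply: val_inj; rewrite /= odd_double_half. Qed.

Lemma prod_double (R : nzRingType) (f : 'I_(2 * n) -> R) :
  \prod_r f r = \prod_i (f (ord_double false i) * f (ord_double true i)).
Proof.
(* Extending [f] by 1 to all naturals lets the induction shorten the range while [f] keeps its
   type. *)
pose g k := oapp f 1 (insub k).
have fE r : f r = g r by rewrite /g valK.
under eq_bigr do rewrite fE; under [RHS]eq_bigr do rewrite !fE.
rewrite -(big_mkord xpredT g).
rewrite -(big_mkord xpredT (fun k => g k.*2 * g k.*2.+1)).
elim: (n) => [|k IHk]; first by rewrite !big_geq.
by rewrite [(2 * _)%N]mulnS !big_nat_recr //= IHk mulrA mul2n.
Qed.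

Definition half_row_fun (s : 'S_n) (r : 'I_(2 * n)) : 'I_(2 * n) :=
  if odd r then r else ord_double false (s (ord_half r)).

Lemma half_row_fun_inj s : injective (half_row_fun s).
Proof.
apply: (can_inj (g := half_row_fun s^-1)) => r; rewrite /half_row_fun.
case: (boolP (odd r)) => [odd_r|even_r]; first by rewrite odd_r.
rewrite odd_ord_double ord_doubleK permK.
by rewrite -[RHS]ord_halfK (negPf even_r).
Qed.

Definition half_row_perm s := perm (@half_row_fun_inj s).

Definition ord_swap (r : 'I_(2 * n)) := ord_double (~~ odd r) (ord_half r).

Lemma ord_swapK : involutive ord_swap.
Proof.
by move=> r; rewrite /ord_swap odd_ord_double ord_doubleK negbK ord_halfK.
Qed.

Definition swap_perm := perm (inv_inj ord_swapK).

(** The first factor moves only even indices, its conjugate only odd ones. *)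
Definition double_perm (s : 'S_n) : 'S_(2 * n) :=
  (half_row_perm s * half_row_perm s ^ swap_perm)%g.

Lemma odd_double_perm s : odd_perm (double_perm s) = false.
Proof. by rewrite odd_permM odd_permJ addbb. Qed.

Lemma double_permE s b i :
  double_perm s (ord_double b i) = ord_double b (s i).
Proof.
have swapE c j : swap_perm (ord_double c j) = ord_double (~~ c) j.
  by rewrite permE /ord_swap odd_ord_double ord_doubleK.
have swapVE c j : (swap_perm^-1)%g (ord_double c j) = ord_double (~~ c) j.
  by apply: (@perm_inj _ swap_perm); rewrite permKV swapE negbK.
have rowE c j : half_row_perm s (ord_double c j) =
    ord_double c (if c then j else s j).
  by rewrite permE /half_row_fun odd_ord_double ord_doubleK; case: c.
by rewrite /double_perm /conjg !permM; case: b; rewrite !(rowE, swapVE, swapE).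
Qed.

Lemma double_perm_inj : injective double_perm.
Proof.
move=> s t eq_st; apply/permP => i.
by apply: (can_inj (ord_doubleK false)); rewrite -!double_permE eq_st.
Qed.

Definition matched (s : 'S_(2 * n)) (i : 'I_n) : bool :=
  let c b := s (ord_double b i) in
  [&& ~~ odd (c false), odd (c true) & ord_half (c false) == ord_half (c true)].

Lemma matched_double_perm s : [forall i, matched (double_perm s) i].
Proof.
apply/forallP=> i.
by rewrite /matched !double_permE !odd_ord_double !ord_doubleK eqxx.
Qed.

(** The images of the even rows are even, so their halves determine them; these halves define an
    injective [t], and the odd rows follow by the common half. *)
Lemma matchedP (s : 'S_(2 * n)) :
  [forall i, matched s i] -> exists t, s = double_perm t.
Proof.
move/forallP=> match_s.
have even_s i : ord_double false (ord_half (s (ord_double false i))) =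
    s (ord_double false i).
  by case/and3P: (match_s i) => /negPf odd_s _ _; rewrite -[RHS]ord_halfK odd_s.
have inj_t : injective (fun i => ord_half (s (ord_double false i))).
  move=> i j eq_ij; apply: (can_inj (ord_doubleK false)).
  apply: (@perm_inj _ s).
  by rewrite -even_s eq_ij even_s.
exists (perm inj_t); apply/permP => r; rewrite -[r]ord_halfK.
rewrite double_permE permE; case: (odd r); last by rewrite even_s.
have [_ odd_s /eqP ->] := and3P (match_s (ord_half r)).
by rewrite -[LHS]ord_halfK odd_s.
Qed.

End HalfIndices.

(** The zero factor cannot be moved to the front in a noncommutative product, hence the induction on
    the list of factors. *)
Lemma prodr_eq0 (R : nzRingType) (T : finType) (f : T -> R) (x : T) :
  f x = 0 -> \prod_y f y = 0.
Proof.
move=> fx0; have: x \in index_enum T by rewrite mem_index_enum.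
elim: (index_enum T) => //= y s IHs; rewrite inE big_cons.
by case/predU1P => [<-|/IHs->]; rewrite ?fx0 ?mul0r ?mulr0.
Qed.

(** * The Cayley determinant of the gadget matrix *)

Section Gadget.
Variables (R : nzRingType) (n : nat) (A : 'M[R]_n).

(** Read as an automaton on states 0 to n: an even row moves from 0 to j+1 and emits an entry of
    [A]; the next odd row can only return from the state that remembers this column. *)
Definition gadget_mx : 'M['M[R]_n.+1]_(2 * n) :=
  \matrix_(r, c)
    let j := lift ord0 (ord_half c) in
    if odd r != odd c then 0
    else if odd r then delta_mx j 0
    else A (ord_half r) (ord_half c) *: delta_mx 0 j.

Definition gadget_coef (s : 'S_(2 * n)) (i : 'I_n) : R :=
  if matched s i then A i (ord_half (s (ord_double false i))) else 0.

Lemma gadget_pair (s : 'S_(2 * n)) (i : 'I_n) :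
  let entry b := gadget_mx (ord_double b i) (s (ord_double b i)) in
  entry false * entry true = gadget_coef s i *: delta_mx 0 0.
Proof.
rewrite /= !mxE !odd_ord_double !ord_doubleK /gadget_coef /matched /=.
case: (odd (s (ord_double false i))); first by rewrite mul0r scale0r.
case: (odd (s (ord_double true i))); last by rewrite mulr0 scale0r.
(* Only the left factor carries a coefficient, so it comes out without commuting anything. *)
rewrite /= -[LHS]scalemxAl mul_delta_mx_cond (inj_eq lift_inj).
by case: eqP; rewrite ?mulr1n ?mulr0n ?scaler0 ?scale0r.
Qed.

(** Left multiplication by [delta_mx 0 0] preserves the entry (0,0). Restricting to this entry also
    covers n = 0, where the product is the identity. *)
Lemma prod_scale_delta (c : 'I_n -> R) :
  (\prod_i (c i *: delta_mx 0 0 : 'M[R]_n.+1)) 0 0 = \prod_i c i.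
Proof.
elim/big_rec2: _ => [|i x X _ <-]; first by rewrite mxE eqxx.
rewrite -[_ * X]scalemxAl mxE [in LHS]mxE (bigD1 0) //= mxE !eqxx mul1r.
by rewrite big1 ?addr0 // => k /negPf k0; rewrite mxE k0 mul0r.
Qed.

Lemma Cdet_gadget : Cdet gadget_mx 0 0 = Cperm A.
Proof.
have termE (s : 'S_(2 * n)) : ((-1) ^+ s * \prod_r gadget_mx r (s r)) 0 0 =
    (-1) ^+ s * \prod_i gadget_coef s i.
  rewrite prod_double; under eq_bigr do rewrite gadget_pair.
  (* The sign is a matrix on the left and an element of [R] on the right, hence the case split. *)
  by case: (odd_perm s); rewrite ?mulN1r ?mul1r ?mxE prod_scale_delta.
rewrite /Cdet summxE; under eq_bigr do rewrite termE.
(* Permutations outside the image of [double_perm] have an unmatched pair, hence a zero factor. *)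
rewrite (bigID (mem [set double_perm t | t : 'S_n])) /= [X in _ + X]big1 ?addr0.
  rewrite big_imset /=; last by move=> s t _ _; apply: double_perm_inj.
  rewrite /Cperm; apply: eq_big => [s|s _]; first by rewrite inE.
  rewrite odd_double_perm mul1r; apply: eq_bigr => i _.
  rewrite /gadget_coef (forallP (matched_double_perm s)).
  by rewrite double_permE ord_doubleK.
move=> s /imsetP not_double.
have [|not_matched] := boolP [forall i, matched s i].
  by case/matchedP=> t st; case: not_double; exists t.
have [i /negPf matchF] := forallPn not_matched.
by rewrite (@prodr_eq0 _ _ _ i) ?mulr0 // /gadget_coef matchF.
Qed.

End Gadget.

(** * Circuits computing the entries of a matrix substitution *)

Section MatrixCircuit.
Variables (F : fieldType) (I J : choiceType) (m : nat).
Variable h : I -> 'I_m.+1 -> 'I_m.+1 -> J + F.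

Definition leaf_value (l : J + F) : ncpoly F J :=
  match l with inl j => ncvar F j | inr c => ncconst J c end.

Definition leaf_mx (i : I) : 'M[ncpoly F J]_m.+1 :=
  \matrix_(a, b) leaf_value (h i a b).

Variable C : circuit F I.

(* For a product gate u computing A *m B, the node (u, a, b, k, true) computes
   A a k * B k b and (u, a, b, k, false) the sum of the first k of these;
   for the other gates k and the boolean are idle. *)
Definition mx_node : finType :=
  (node C * 'I_m.+1 * 'I_m.+1 * 'I_m.+2 * bool)%type.

(** At [ord_max], that is m+1, the partial sum of a product gate is complete. *)
Definition entry_node (u : node C) (a b : 'I_m.+1) : mx_node :=
  (u, a, b, ord_max, false).

Definition mx_label (x : mx_node) : gate F J mx_node :=
  let: (u, a, b, k, is_term) := x in
  match label u with
  | GVar i => match h i a b with inl j => GVar _ _ j | inr c => GConst _ _ c end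
  | GConst c => GConst _ _ (if a == b then c else 0)
  | GAdd v w => GAdd _ _ (entry_node v a b) (entry_node w a b)
  | GMul v w =>
    if is_term then
      (* For k = m+1 the index [inord k] defaults to 0; no sum refers to that term. *)
      GMul _ _ (entry_node v a (inord k)) (entry_node w (inord k) b)
    else if (k : nat) is k'.+1 then
      GAdd _ _ (u, a, b, inord k', false) (u, a, b, inord k', true)
    else GConst _ _ 0
  end.

(** A lexicographic rank: [2 * k + is_term] stays below [2 * m.+2], so descending in [C] dominates.
    Within a gate, sum k+1 ranks above term k, and term k above sum k. *)
Definition mx_rank (x : mx_node) : nat :=
  let: (u, _, _, k, is_term) := x in
  (#|connect (@child _ _ C) u| * (2 * m.+2) + (2 * k + is_term))%N.

Arguments mx_rank : simpl never.

Lemma mx_rank_lt (u v : node C) a b k t a' b' k' t' :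
  child u v -> (mx_rank (v, a', b', k', t') < mx_rank (u, a, b, k, t))%N.
Proof.
move/child_card => lt_vu; rewrite /mx_rank.
apply: (@leq_trans (#|connect (@child _ _ C) v|.+1 * (2 * m.+2))%N); last first.
  by apply: leq_trans (leq_addr _ _); rewrite leq_mul2r lt_vu orbT.
rewrite [X in (_ < X)%N]mulSnr ltn_add2l.
apply: (@leq_trans (2 * k'.+1)%N); last by rewrite leq_mul2l ltn_ord.
by rewrite mulnSr -addnS leq_add2l; case: t'.
Qed.

Lemma mx_label_rank (x y : mx_node) :
  y \in children (mx_label x) -> (mx_rank y < mx_rank x)%N.
Proof.
case: x => [[[[u a] b] k] t] /=; case label_u: (label u) => [i|c|v w|v w] //=.
- by case: (h i a b).
- by rewrite !inE => /orP[] /eqP->; apply: mx_rank_lt;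
    rewrite /child /= label_u !inE eqxx ?orbT.
case: t => /=.
  by rewrite !inE => /orP[] /eqP->; apply: mx_rank_lt;
    rewrite /child /= label_u !inE eqxx ?orbT.
case k_eq: (k : nat) => [|k'] //=.
have lt_k' : (k' < m.+2)%N by apply: ltnW; rewrite -k_eq.
by rewrite !inE => /orP[] /eqP->;
  rewrite /mx_rank ltn_add2l inordK // k_eq !mul2n doubleS /= ?addn0 ?addn1.
Qed.

Lemma mx_label_acyclic (x y : mx_node) :
  let child' := [rel x y | y \in children (mx_label x)] in
  child' x y -> ~~ connect child' y x.
Proof.
move=> child' xy; apply/negP => /connectP[p].
have: (mx_rank y < mx_rank x)%N by apply: mx_label_rank.
elim: p y {xy} => [|z p IHp] y lt_yx /=.
  by move=> _ x_y; rewrite x_y ltnn in lt_yx.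
by case/andP => /mx_label_rank lt_zy; apply: IHp; apply: ltn_trans lt_yx.
Qed.

Definition mx_circuit (a b : 'I_m.+1) : circuit F J :=
  Circuit (entry_node (output C) a b) mx_label_acyclic.

Lemma mx_circuit_size a b :
  circuit_size (mx_circuit a b) = (circuit_size C * (m.+1 * m.+1 * m.+2 * 2))%N.
Proof. by rewrite /circuit_size /= !card_prod !card_ord card_bool !mulnA. Qed.

Lemma mx_circuit_computes (f : ncpoly F I) a b :
  computes C f -> computes (mx_circuit a b) (mx_subst leaf_mx f a b).
Proof.
case=> val valP <-.
pose phi u := mx_subst leaf_mx (val u).
pose term v w a b (k : 'I_m.+1) := phi v a k * phi w k b.
(* The valuation is given explicitly; what remains is to check it gate by gate. *)
pose val' (x : mx_node) : ncpoly F J :=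
  let: (u, a, b, k, is_term) := x in
  match label u with
  | GMul v w => if is_term then term v w a b (inord k)
                else \sum_(l < k) term v w a b (inord l)
  | _ => phi u a b
  end.
have entryE u c d : val' (entry_node u c d) = phi u c d.
  rewrite /val' /entry_node; case label_u: (label u) => [i|e|v w|v w] //.
  rewrite /phi valP label_u /= rmorphM mxE.
  by apply: eq_bigr => l _; rewrite /term inord_val.
have val'E u c d k t : val' (u, c, d, k, t) = match label u with
    | GMul v w => if t then term v w c d (inord k)
                  else \sum_(l < k) term v w c d (inord l)
    | _ => phi u c d
    end by [].
clearbody val'; exists val'; last exact: entryE.
case=> [[[[u c] d] k] t]; rewrite val'E /=.
case label_u: (label u) => [i|e|v w|v w].
- rewrite /phi valP label_u /= mx_substU mxE.
  by case: (h i c d).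
- rewrite /phi valP label_u /= mx_substC mxE.
  by case: eqP => _ //; rewrite /ncconst malgC0E.
- by rewrite /= !entryE /phi valP label_u /= rmorphD mxE.
case: t; first by rewrite /= !entryE.
case k_eq: (k : nat) => [|k'] /=; first by rewrite big_ord0 /ncconst malgC0E.
have lt_k' : (k' < m.+2)%N by apply: ltnW; rewrite -k_eq.
by rewrite !val'E label_u big_ord_recr /= inordK.
Qed.

End MatrixCircuit.

(** * Gadget entries as circuit leaves *)

Section GadgetLeaves.
Variables (F : fieldType) (n : nat).

(** The (c,d) entry of [l] times the matrix unit at (a,b), kept as a leaf label. *)
Definition delta_leaf (J : Type) (l : J + F) (a b c d : 'I_n.+1) : J + F :=
  if (c == a) && (d == b) then l else inr 0.

Definition gadget_leaf (p : 'I_(2 * n) * 'I_(2 * n)) (c d : 'I_n.+1) :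
    'I_n * 'I_n + F :=
  let: (r, s) := p in
  let j := lift ord0 (ord_half s) in
  if odd r != odd s then inr 0
  else if odd r then delta_leaf (inr 1) j 0 c d
  else delta_leaf (inl (ord_half r, ord_half s)) 0 j c d.

Lemma gadget_leafE :
  map_mx (mx_subst (leaf_mx gadget_leaf)) (varmx F (2 * n)) =
  gadget_mx (varmx F n).
Proof.
apply/matrixP => r s; rewrite !mxE mx_substU; apply/matrixP => c d.
rewrite !mxE /gadget_leaf /delta_leaf.
have ncconst0 : ncconst ('I_n * 'I_n)%type (0 : F) = 0 by apply: malgC0E.
case: ifP => _; first by rewrite mxE.
case: ifP => _; rewrite !mxE; case: andP => _ /=.
- by rewrite mulr1n /ncconst rmorph1.
- by [].
- by rewrite mulr1n mulr1.
by rewrite mulr0n mulr0.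
Qed.

End GadgetLeaves.

(** * From determinant circuits to permanent circuits *)

Lemma rmorph_Cdet (R S : nzRingType) (phi : {rmorphism R -> S}) n
    (A : 'M[R]_n) :
  phi (Cdet A) = Cdet (map_mx phi A).
Proof.
rewrite /Cdet rmorph_sum; apply: eq_bigr => s _.
by rewrite rmorphM rmorph_sign rmorph_prod;
  under [in RHS]eq_bigr do rewrite mxE.
Qed.

Theorem theorem4p5 (F : fieldType) :
  exists p : {poly {poly nat}}, forall n s : nat,
    (exists2 C : circuit F ('I_(2 * n) * 'I_(2 * n))%type,
       circuit_size C = s & computes C (Cdet (varmx F (2 * n)))) ->
    (exists2 C' : circuit F ('I_n * 'I_n)%type,
       (circuit_size C' <= p.[s, n])%N & computes C' (Cperm (varmx F n))).
Proof.
(* The outer variable stands for s, the inner one for n; the value is the node count of [mx_circuit]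
   for matrices of order n+1. *)
exists ('X * (('X + 1%:P) * ('X + 1%:P) * ('X + 2%:P) * 2%:P)%:P) => n s.
case=> C <- C_det; exists (mx_circuit (@gadget_leaf F n) C 0 0).
  by rewrite mx_circuit_size !hornerE -[n.+2]addn1 -[n.+1]addn1.
rewrite -(Cdet_gadget (varmx F n)) -gadget_leafE -rmorph_Cdet.
exact: mx_circuit_computes.
Qed.
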